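(* Let $X$ be an infinite compact metrizable space and $h\colon X\to X$ a minimal homeomorphism. If $(X,h)$ has the topological small boundary property, then $(X,h)$ has the dynamic comparison property.
   Context: $M_h(X)$ denotes the set of $h$-invariant Borel probability measures on $X$. A Borel set $E\subset X$ is universally null if $\mu(E)=0$ for all $\mu\in M_h(X)$. $\partial A$ denotes the topological boundary of $A\subset X$. A closed set $F\subset X$ is topologically $h$-small if there is $m\in\mathbb{Z}_{+}$ such that whenever $d(0),\dots,d(m)$ are $m+1$ distinct integers, $h^{d(0)}(F)\cap\cdots\cap h^{d(m)}(F)=\varnothing$. $(X,h)$ has the topological small boundary property if whenever $F,K\subset X$ are disjoint compact sets, there exist open sets $U,V\subset X$ with $F\subset U$, $K\subset V$, $\overline{U}\cap\overline{V}=\varnothing$ and $\partial U$ topologically $h$-small. $(X,h)$ has the dynamic comparison property if whenever $U\subset X$ is open and $C\subset X$ is closed with $\partial C,\partial U$ universally null and $\mu(C)<\mu(U)$ for every $\mu\in M_h(X)$, there exist $M\in\mathbb{N}$, continuous functions $f_j\colon X\to[0,1]$ ($0\le j\le M$) and integers $d(0),\dots,d(M)$ such that $\sum_{j=0}^M f_j=1$ on $C$ and the sets $\mathrm{supp}(f_j\circ h^{-d(j)})$, $0\le j\le M$, are pairwise disjoint subsets of $U$. *)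

(* Defs.v *)
From HB Require Import structures.
From mathcomp Require Import all_boot all_order all_algebra.
From mathcomp Require Import all_classical all_reals all_analysis.
Set Implicit Arguments. Unset Strict Implicit. Unset Printing Implicit Defensive.
Import Order.TTheory GRing.Theory Num.Theory numFieldTopology.Exports.
Local Open Scope classical_set_scope.
Local Open Scope ring_scope.

Notation borel_type X := (g_sigma_algebraType (@open X)).

Definition hpow {X : Type} (h hi : X -> X) (n : int) : X -> X :=
  match n with
  | Posz k => iter k h
  | Negz k => iter k.+1 hi
  end.

Definition homeomorphism {X : ptopologicalType} (h hi : X -> X) : Prop :=
  continuous h /\ continuous hi /\ cancel h hi /\ cancel hi h.

Definition minimal_homeo {X : ptopologicalType} (h hi : X -> X) : Prop :=
  forall x : X, closure [set hpow h hi n x | n in [set: int]] = [set: X].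

Definition invariant_prob {R : realType} {X : ptopologicalType} (h : X -> X)
  (mu : probability (borel_type X) R) : Prop :=
  forall A : set (borel_type X), measurable A ->
    mu (h @^-1` A) = mu A.

Definition boundary {X : ptopologicalType} (A : set X) : set X :=
  closure A `\` interior A.

Definition universally_null {R : realType} {X : ptopologicalType} (h : X -> X)
  (E : set X) : Prop :=
  measurable (E : set (borel_type X)) /\
  forall mu : probability (borel_type X) R, invariant_prob h mu ->
    mu (E : set (borel_type X)) = 0%E.

Definition top_small {X : ptopologicalType} (h hi : X -> X) (F : set X) : Prop :=
  closed F /\
  exists m : nat, forall d : 'I_m.+1 -> int, injective d ->
    \bigcap_(i in [set: 'I_m.+1]) (hpow h hi (d i) @` F) = set0.

Definition top_small_boundary_property {X : ptopologicalType} (h hi : X -> X)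
  : Prop :=
  forall F K : set X, compact F -> compact K -> F `&` K = set0 ->
    exists U V : set X, [/\ open U /\ open V, F `<=` U, K `<=` V,
      closure U `&` closure V = set0 & top_small h hi (boundary U)].

Definition supp {X : ptopologicalType} {R : realType} (f : X -> R) : set X :=
  closure [set x | f x != 0].

Definition dynamic_comparison_property {R : realType} {X : ptopologicalType}
  (h hi : X -> X) : Prop :=
  forall U C : set X, open U -> closed C ->
    universally_null (R := R) h (boundary C) ->
    universally_null (R := R) h (boundary U) ->
    (forall mu : probability (borel_type X) R, invariant_prob h mu ->
       (mu (C : set (borel_type X)) < mu (U : set (borel_type X)))%E) ->
    exists (M : nat) (f : 'I_M.+1 -> X -> R) (d : 'I_M.+1 -> int),
      [/\ (forall j, continuous (f j)),
          (forall j x, 0 <= f j x <= 1),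
          (forall x, C x -> \sum_(j < M.+1) f j x = 1),
          (forall j, supp (f j \o hpow h hi (- d j)) `<=` U) &
          (forall j k, j != k ->
             supp (f j \o hpow h hi (- d j)) `&` supp (f k \o hpow h hi (- d k))
               = set0)].

(* Main.v *)
Require Import Defs.
From HB Require Import structures.
From mathcomp Require Import all_boot all_order all_algebra.
From mathcomp Require Import all_classical all_reals all_analysis.
From mathcomp Require Import finmap zify lra.
Import Order.TTheory GRing.Theory Num.Theory numFieldNormedType.Exports.
Local Open Scope classical_set_scope.
Local Open Scope ring_scope.

(* If no uniform [N] made every orbit segment of length [N] visit a closed
   [K] inside [U] more often than an open [O] around [C], the empirical
   frequencies along bad segments would have an ultralimit, which regularizes to
   an invariant probability contradicting [mu C < mu U]. The small boundary
   property then allows [C] and [U] to be replaced by sets [C'] and [U'] with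
   topologically small boundary, still satisfying the count. Inside the Boolean
   algebra of such sets, let each point of [C'] look for a free place of [U']
   along its forward orbit, the displacements 0, 1, 2, ... being tried one after
   the other: the count forces every point to be placed before time [N]. This is
   the required decomposition up to the boundaries of its pieces, a
   topologically small closed set. Such a set [F] goes into any nonempty open
   set, by induction on the number of visits of an orbit to [F]: the points of
   [F] that return to [F] within time [R] form a closed set with one visit less,
   and away from it the translates of [F] by 0, ..., R are disjoint. A small
   open part of [U'] is kept free for this purpose. *)

(** * Integer powers of an invertible map *)

Section powers.
Context (X : Type) (h hi : X -> X) (hK : cancel h hi) (hiK : cancel hi h).
Local Notation hp := (hpow h hi).

Lemma hpow_succ (n : int) x : hp (n + 1) x = h (hp n x).
Proof.
case: n => n; first by rewrite addrC.
case: n => [|n]; first by rewrite /= hiK.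
have -> : Negz n.+1 + 1 = Negz n by lia.
by rewrite [hp (Negz n.+1) x]/= hiK.
Qed.

Lemma hpow_pred (n : int) x : hp (n - 1) x = hi (hp n x).
Proof. by rewrite -[n in RHS](subrK 1) hpow_succ hK. Qed.

Lemma hpowD (m n : int) x : hp (m + n) x = hp m (hp n x).
Proof.
elim: m => [|m IH|m IH]; first by rewrite add0r.
- by rewrite -addn1 PoszD addrAC !hpow_succ IH.
- have mS : - m.+1%:Z + n = - m%:Z + n - 1 by lia.
  have mS1 : - m.+1%:Z = - m%:Z - 1 by lia.
  by rewrite mS mS1 !hpow_pred IH.
Qed.

Lemma hpowK (n : int) : cancel (hp n) (hp (- n)).
Proof. by move=> x; rewrite -hpowD addNr. Qed.

Lemma hpowKN (n : int) : cancel (hp (- n)) (hp n).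
Proof. by move=> x; rewrite -hpowD addrN. Qed.

End powers.

(** * Separation of closed sets in normal spaces *)

Section normal.
Context {X : topologicalType} (nX : normal_space X).

Lemma normal_shrink (A W : set X) : closed A -> open W -> A `<=` W ->
  exists O, [/\ open O, A `<=` O & closure O `<=` W].
Proof.
move=> cA oW AW; have /(nX _ cA)[B + BW] : set_nbhs A W.
  by apply/set_nbhsP; exists W; split.
move=> /set_nbhsP[ O [ oO AO OB]]; exists O; split => //.
exact: subset_trans (closureS OB) BW.
Qed.

(** The last clause keeps empty members empty, so a family with finitely many nonempty members stays
    such after thickening. *)
Lemma normal_shrink_family {I : Type} (A W : I -> set X) :
  (forall i, closed (A i)) -> (forall i, open (W i)) ->
  (forall i, A i `<=` W i) ->
  exists O : I -> set X, forall i, [/\ open (O i), A i `<=` O i,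
    closure (O i) `<=` W i & (A i = set0 -> O i = set0)].
Proof.
move=> cA oW AW; have /choice[ O OP] i : exists O, [/\ open O, A i `<=` O,
    closure O `<=` W i & (A i = set0 -> O = set0)].
  have [A0|A0] := pselect (A i = set0).
    by exists set0; rewrite A0; split => //; [exact: open0|rewrite closure0].
  have [ O [ oO AO OW]] := normal_shrink _ _ (cA i) (oW i) (AW i).
  by exists O.
by exists O.
Qed.

(** Shrink twice: first to neighbourhoods [G i] of [B i], then to [O i] whose closure lies in [G i]
    and avoids the closures of the other [G j]. Finiteness of the nonempty members keeps the removed
    unions closed. *)
Lemma disjoint_closed_nbhs {I : choiceType} (B : I -> set X) (V : set X) :
  open V -> finite_set [set i | B i !=set0] -> (forall i, closed (B i)) ->
  (forall i, B i `<=` V) -> (forall i j y, B i y -> B j y -> i = j) ->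
  exists O : I -> set X, [/\ forall i, open (O i), forall i, B i `<=` O i,
    forall i, B i = set0 -> O i = set0, forall i, closure (O i) `<=` V &
    forall i j y, closure (O i) y -> closure (O j) y -> i = j].
Proof.
move=> oV fB cB BV dB.
pose D := [set i | B i !=set0].
have oW i : open (V `\` \bigcup_(j in D `\ i) B j).
  apply: openI => //; apply: closed_openC; apply: closed_bigcup => //.
  exact: finite_setD.
have [i|G GP] := normal_shrink_family B _ cB oW.
  move=> y By; split; first exact: BV By.
  by move=> [j [_ +] Bj]; apply; rewrite (dB _ _ _ By Bj).
have cG i : open (G i `\` \bigcup_(j in D `\ i) closure (G j)).
  apply: openI; first by case: (GP i).
  apply: closed_openC; apply: closed_bigcup; first exact: finite_setD.
  by move=> *; exact: closed_closure.
have [i|O OP] := normal_shrink_family B _ cB cG.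
  move=> y By; split; first by case: (GP i) => _ + _ _; exact.
  move=> [j [_ ji] /=]; case: (GP j) => _ _ + _ => /[apply] -[_]; apply.
  by exists i => //; split; [exists y|apply/nesym].
exists O; split => i; try by case: (OP i).
  case: (OP i) => _ _ Oi _ y /Oi[Gy _]; case: (GP i) => _ _ Gi _.
  by have [] := Gi _ (subset_closure Gy).
move=> j y Oiy Ojy; apply: contrapT => ij.
case: (OP i) => _ _ /(_ _ Oiy)[Giy +] _; apply.
case: (OP j) => _ _ /(_ _ Ojy)[Gjy _] Oj0.
exists j; last exact: subset_closure.
split; last by apply/nesym.
by apply: contrapT => /nonemptyPn /Oj0 O0; move: Ojy; rewrite O0 closure0.
Qed.

End normal.

(** * Moving closed sets into open sets along orbits *)

Section dynamics.
Context {X : ptopologicalType} (h hi : X -> X).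
Local Notation hp := (hpow h hi).

Definition visits_le (m : nat) (F : set X) := forall x (s : seq int),
  uniq s -> (forall t, t \in s -> F (hp t x)) -> (size s <= m)%N.

(* [A d] is the piece moved by [h^d]; pieces with the same displacement are
   merged into one. *)
Definition matching (A : int -> set X) (V : set X) :=
  [/\ finite_set [set d | A d !=set0], forall d, closed (A d),
      forall d x, A d x -> V (hp d x) &
      forall d e x y, A d x -> A e y -> hp d x = hp e y -> d = e].

Definition covers (A : int -> set X) (C : set X) :=
  forall x, C x -> exists d, A d x.

Context (homh : homeomorphism h hi).

Let hK : cancel h hi. Proof. by case: homh => _ [_ []]. Qed.
Let hiK : cancel hi h. Proof. by case: homh => _ [_ []]. Qed.

Lemma hpow_continuous n : continuous (hp n).
Proof.
have iter_cont (f : X -> X) k : continuous f -> continuous (iter k f).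
  move=> cf; elim: k => [|k IH] x; first exact: cvg_id.
  by apply: (@continuous_comp _ _ _ (iter k f) f); [exact: IH|exact: cf].
by case: homh => ch [chi _]; case: n => n; exact: iter_cont.
Qed.

Lemma hpow_open n (A : set X) : open A -> open (hp n @^-1` A).
Proof. by move=> oA; apply: open_comp => // x _; exact: hpow_continuous. Qed.

Lemma hpow_closed n (A : set X) : closed A -> closed (hp n @^-1` A).
Proof. by have /continuous_closedP := hpow_continuous n; exact. Qed.

(** A point lies in the image of [F] under [hp d] exactly when its orbit is in [F] at time [- d]; so
    [m + 1] distinct visits would give a point of an empty intersection. *)
Lemma top_small_visits F : top_small h hi F -> closed F /\ exists m, visits_le m F.
Proof.
move=> [cF [m Fm]]; split => //; exists m => x s us sF.
rewrite leqNgt; apply/negP => ms.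
have inj : injective (fun i : 'I_m.+1 => - s`_i).
  move=> i j /oppr_inj /eqP; rewrite nth_uniq//; first by move=> /eqP/val_inj.
  - exact: leq_trans (ltn_ord i) _.
  - exact: leq_trans (ltn_ord j) _.
suff : (\bigcap_(i in [set: 'I_m.+1]) (hp (- s`_i) @` F)) x by rewrite Fm.
move=> i _; exists (hp s`_i x); last by rewrite hpowK.
by apply/sF/mem_nth; exact: leq_trans (ltn_ord i) ms.
Qed.

Lemma visits_leS m n F G : visits_le m F -> G `<=` F -> (m <= n)%N ->
  visits_le n G.
Proof.
move=> Fm GF mn x s us sG; apply: leq_trans mn.
by apply: (Fm x) => // t /sG; exact: GF.
Qed.

Lemma visits_leU m n F G : visits_le m F -> visits_le n G ->
  visits_le (m + n) (F `|` G).
Proof.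
move=> Fm Gn x s us sFG; rewrite -(count_predC (fun t => `[< F (hp t x) >])).
rewrite -!size_filter leq_add//.
  apply: (Fm x); first exact: filter_uniq.
  by move=> t; rewrite mem_filter => /andP[/asboolP].
apply: (Gn x); first exact: filter_uniq.
by move=> t; rewrite mem_filter => /andP[/asboolP ? /sFG[]].
Qed.

Lemma visits_le_preimage m F n : visits_le m F -> visits_le m (hp n @^-1` F).
Proof.
move=> Fm x s us sF; rewrite -(size_map (+%R n)).
apply: (Fm x); first by rewrite map_inj_uniq//; exact: addrI.
by move=> _ /mapP[t /sF + ->]; rewrite hpowD.
Qed.

Context (nX : normal_space X).

(** The pieces [A d] may overlap, but their targets [B d] do not. The separation is made among the
    targets and pulled back by the powers of [h]. *)
Lemma matching_nbhs A V : open V -> matching A V ->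
  exists O : int -> set X, [/\ forall d, open (O d), forall d, A d `<=` O d &
    matching (closure \o O) V].
Proof.
move=> oV [fA cA AV dA].
pose B d := hp (- d) @^-1` A d.
have B0 d : B d = set0 -> A d = set0.
  move=> Bd; rewrite -subset0 => x Ax; suff : B d (hp d x) by rewrite Bd.
  by rewrite /B /preimage /mkset hpowK.
have [||||O [ oO BO O0 OV dO]] := @disjoint_closed_nbhs _ nX _ B V oV.
- apply: sub_finite_set fA => d [y By]; by exists (hp (- d) y).
- by move=> d; exact: hpow_closed.
- by move=> d y By; rewrite -[y](hpowKN _ _ _ hK hiK d); exact: AV.
- by move=> d e y By Bey; apply: (dA _ _ _ _ By Bey); rewrite !hpowKN.
exists (fun d => hp d @^-1` O d).
have cl d x : closure (hp d @^-1` O d) x -> closure (O d) (hp d x).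
  have : hp d @^-1` O d `<=` hp d @^-1` closure (O d).
    by apply: preimage_subset; exact: subset_closure.
  move=> /closureS /[apply].
  by rewrite -((closure_id _).1 (hpow_closed d _ (@closed_closure _ _))).
split => [d|d x Ax|]; first exact: hpow_open.
  by apply: BO; rewrite /B /preimage /mkset hpowK.
split => /=.
- apply: sub_finite_set fA => d /= [x /cl Ox].
  apply: contrapT => /nonemptyPn A0.
  have /O0 O0' : B d = set0 by rewrite /B A0.
  by move: Ox; rewrite O0' closure0.
- by move=> d; exact: closed_closure.
- by move=> d x /cl; exact: OV.
- by move=> d e x y /cl Ox /cl Oy xy; apply: (dO d e (hp d x)) => //; rewrite xy.
Qed.

Context (hausX : hausdorff_space X) (cptX : compact [set: X])
  (infX : ~ finite_set [set: X]) (minh : minimal_homeo h hi).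

Lemma closed_point (x : X) : closed [set x].
Proof. exact/accessible_closed_set1/hausdorff_accessible. Qed.

Lemma minimal_visit (V : set X) x : open V -> V !=set0 -> exists n, V (hp n x).
Proof.
move=> oV [z Vz]; have : closure [set hp n x | n in [set: int]] z by rewrite minh.
move=> /(_ V (open_nbhs_nbhs (conj oV Vz)))[_ [[n _ <-] Vn]].
by exists n.
Qed.

Lemma minimal_cover (V : set X) : open V -> V !=set0 ->
  exists R : nat, forall x, exists2 d : nat, (d <= R)%N & V (hp d x).
Proof.
move=> oV V0; move: cptX; rewrite compact_cover.
case/(_ int setT (fun n => hp n @^-1` V)).
- by move=> n _; exact: hpow_open.
- by move=> x _; have [n] := minimal_visit V x oV V0; exists n.
move=> D _ cD; pose r := (\sum_(n <- finmap.enum_fset D) absz n)%N.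
have Dr n : n \in D -> (absz n <= r)%N.
  by move=> nD; rewrite /r (big_rem _ nD)/= leq_addr.
(* The finitely many times of the subcover lie between [- r] and [r]; starting from [hp r x] makes
   them nonnegative. *)
exists (r + r)%N => x; have [//|n /Dr nr Vn] := cD (hp r x).
exists (absz (n + r)); first by lia.
have -> : (absz (n + r))%:Z = n + r by lia.
by rewrite hpowD.
Qed.

(** A periodic point has a finite, hence closed, orbit, which by minimality would be the whole
    infinite space. *)
Lemma minimal_aperiodic (x : X) (n : nat) : (0 < n)%N -> hp n x <> x.
Proof.
move=> n0 nx; apply: infX; rewrite -(minh x).
have hq (q : int) : hp (q * n%:Z) x = x.
  elim: q => [|q IH|q IH]; first by rewrite mul0r.
    by rewrite -addn1 PoszD mulrDl mul1r hpowD// nx.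
  have -> : - q.+1%:Z = - q%:Z - 1 by lia.
  by rewrite mulrBl mul1r hpowD// -[x in hp (- _) x]nx hpowK.
have -> : [set hp k x | k in [set: int]] = (fun i : nat => hp i x) @` `I_n.
  apply/seteqP; split=> _ [k kn <-]; last by exists k%:Z.
  exists (absz (k %% n%:Z)%Z).
    rewrite /= -ltz_nat gez0_abs ?modz_ge0//; last by rewrite -lt0n.
    by apply: ltz_pmod; rewrite ltz_nat.
  rewrite gez0_abs ?modz_ge0//; last by rewrite -lt0n.
  have {2}-> : k = (k %% n%:Z)%Z + (k %/ n%:Z)%Z * n%:Z by rewrite addrC -divz_eq.
  by rewrite hpowD// hq.
have fin : finite_set ((fun i : nat => hp i x) @` `I_n).
  exact/finite_image/finite_II.
rewrite -((closure_id _).1 _)//.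
by apply: (accessible_finite_set_closed.1 _ _ fin); exact: hausdorff_accessible.
Qed.

(** If [V] were the single point [z], every orbit would reach [z] within a bounded time, and the
    space would be finite. *)
Lemma minimal_two_points (V : set X) z : open V -> V z -> exists2 y, V y & y <> z.
Proof.
move=> oV Vz; apply: contrapT => nV; apply: infX.
have V1 y : V y -> y = z by move=> Vy; apply: contrapT => yz; apply: nV; exists y.
have [|R VR] := minimal_cover V oV; first by exists z.
apply: (@sub_finite_set _ _ ((fun i : nat => hp (- i%:Z) z) @` `I_R.+1)).
  move=> x _; have [d dR /V1 <-] := VR x.
  by exists d => //=; rewrite hpowK.
exact/finite_image/finite_II.
Qed.

(* Induction on [m]: the points of [F] returning to [F] within time [R] are
   visited at most [m - 1] times, since the last visit of an orbit is not among
   them; away from these points, the first [R] translates of [F] are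
   disjoint. *)
Lemma small_matching m F V : closed F -> visits_le m F -> open V -> V !=set0 ->
  exists2 A, matching A V & covers A F.
Proof.
elim: m F V => [|m IH] F V cF Fm oV [z Vz].
  exists (fun=> set0) => [|x Fx]; last first.
    suff : (size [:: 0%:Z] <= 0)%N by [].
    by apply: (Fm x) => // t; rewrite inE => /eqP ->.
  split => // [|_]; last exact: closed0.
  by apply: sub_finite_set (finite_set0 _) => d [].
(* [V] is divided in two: [V0] around [z] receives the points that do not return soon, and the
   complement of its closure, which contains [y], is left to the induction. *)
have [y Vy yz] := minimal_two_points V z oV Vz.
have [|||V0 [ oV0 zV0 cV0]] := normal_shrink nX [set z] (V `\ y).
- exact: closed_point.
- by apply: openI => //; apply: closed_openC; exact: closed_point.
- by move=> _ ->; split => // zy; apply: yz.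
have [|R VR] := minimal_cover V0 oV0; first by exists z; exact: zV0.
pose F' := F `&` \bigcup_(k in `I_R) (hp k.+1 @^-1` F).
have [||||A1 mA1 cA1] := IH F' (V `\` closure V0).
- apply: closedI => //; apply: closed_bigcup; first exact: finite_II.
  by move=> k _; exact: hpow_closed.
- move=> x [|t0 s] us sF //.
  have [t [ts tmax]] : exists t, t \in t0 :: s /\ forall u, u \in t0 :: s -> u <= t.
    have := @arg_maxP _ _ _ ord0 predT (fun i : 'I_(size s).+1 => (t0 :: s)`_i) isT.
    case=> i _ imax; exists (t0 :: s)`_i; split; first exact: mem_nth.
    by move=> u /(nthP 0)[j js <-]; exact: (imax (Ordinal js)).
  (* The latest listed visit [t] to [F'] is followed by a visit to [F] at time [k.+1 + t], which is
     not in the list: [F] has at least one visit more than [F']. *)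
  have [_ [k kR]] := sF _ ts; rewrite /preimage /mkset -hpowD// => Fk.
  have := Fm x (k.+1%:Z + t :: t0 :: s); apply => [|u].
    rewrite cons_uniq us andbT; apply/negP => /tmax; lia.
  by rewrite inE => /orP[/eqP -> //|/sF[]].
- by apply: openI => //; apply: closed_openC; exact: closed_closure.
- exists y; split => // /cV0[_]; exact.
have oV1 : open (V `\` closure V0).
  by apply: openI => //; apply: closed_openC; exact: closed_closure.
have [ O [ oO AO [fO clO OV dO]]] := matching_nbhs _ _ oV1 mA1.
(* The induction has covered [F'] by the open sets [O d], so no point of [E] returns to [F] at a
   time from 1 to [R]. *)
pose E := F `\` \bigcup_d O d.
have cE : closed E.
  by apply: closedI => //; apply: open_closedC; apply: bigcup_open => d _.
(* By the choice of [R], every point of [E] is in [V0] at some time from 0 to [R]; taking the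
   closure of [V0] makes the pieces closed. *)
pose E_ (d : int) := if (0 <= d) && (d <= R%:Z) then E `&` hp d @^-1` closure V0
  else set0.
have E_P d x : E_ d x -> [/\ 0 <= d, d <= R%:Z, E x & closure V0 (hp d x)].
  by rewrite /E_; case: ifP => // /andP[? ?] [].
(* If the targets met, then [w] would reach [x], a point of [F], at time [e - d], which is at most
   [R]; so [w] would be in [F']. *)
have E_disj (d e : int) x w : d < e -> E_ d x -> E_ e w -> hp d x <> hp e w.
  move=> de /E_P[d0 dR [Fx _] _] /E_P[e0 eR [Fw nOw] _] xw; apply: nOw.
  have [|k Aky] := cA1 w; last by exists k => //; exact: AO.
  split => //; exists (absz (e - d)).-1; first by rewrite /=; lia.
  have -> : ((absz (e - d)).-1).+1%:Z = - d + e by lia.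
  by rewrite /preimage /mkset hpowD// -xw hpowK.
have E_inj d e x w : E_ d x -> E_ e w -> hp d x = hp e w -> d = e.
  move=> Ex Ew xw; apply/eqP; rewrite eq_le !leNgt; apply/andP; split; apply/negP.
    by move=> /E_disj /(_ Ew Ex); apply; rewrite xw.
  by move=> /E_disj /(_ Ex Ew); apply.
have V0V : closure V0 `<=` V by move=> u /cV0[].
exists (fun d => E_ d `|` closure (O d)); last first.
  move=> x Fx; have [[d _ Odx]|nO] := pselect ((\bigcup_d O d) x).
    by exists d; right; exact: subset_closure.
  have [d dR Vdx] := VR x; exists d; left.
  rewrite /E_ ifT; last by apply/andP; split; lia.
  by split; [split|exact: subset_closure].
split.
- apply: (@sub_finite_set _ _ ([set d | closure (O d) !=set0] `|`
    (Posz @` `I_R.+1))).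
    move=> d [x [/E_P[d0 dR _ _]|Ox]]; [right|left]; last by exists x.
    by exists (absz d); rewrite /=; lia.
  by rewrite finite_setU; split => //; exact/finite_image/finite_II.
- move=> d; apply: closedU; last exact: closed_closure.
  rewrite /E_; case: ifP => _; last exact: closed0.
  by apply: closedI => //; apply: hpow_closed; exact: closed_closure.
- by move=> d x [/E_P[_ _ _ /V0V]//|/OV[]].
- move=> d e x w [Ex|Ox] [Ey|Oy] xy.
  + exact: E_inj Ex Ey xy.
  + by have [_ []] := OV _ _ Oy; have [_ _ _] := E_P _ _ Ex; rewrite xy.
  + by have [_ []] := OV _ _ Ox; have [_ _ _] := E_P _ _ Ey; rewrite xy.
  + exact: dO Ox Oy xy.
Qed.

End dynamics.

(** * Boundaries under Boolean operations *)

Section boundary.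
Context {X : ptopologicalType}.
Implicit Types A B : set X.

Lemma closed_boundary A : closed (boundary A).
Proof.
apply: closedI; first exact: closed_closure.
by apply: open_closedC; exact: open_interior.
Qed.

Lemma boundaryC A : boundary (~` A) = boundary A.
Proof. by rewrite /boundary closure_setC interiorC setDE setCK setIC -setDE. Qed.

Lemma boundaryI A B : boundary (A `&` B) `<=` boundary A `|` boundary B.
Proof.
move=> x [/closureI[cA cB]]; rewrite interiorI => nI.
have [iA|nA] := pselect (interior A x); last by left.
by right; split => // iB; exact: nI.
Qed.

Lemma closure_boundary A x : closure A x -> ~ boundary A x -> A x.
Proof.
move=> cA nb; apply: (@interior_subset _ A).
by apply: contrapT => nA; apply: nb.
Qed.

End boundary.

(** * Matching from orbit counts *)

Section matching_of_counts.
Context {X : ptopologicalType} (h hi : X -> X).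
Local Notation hp := (hpow h hi).

(** Closedness need not be recorded, as a boundary is always closed. *)
Definition small_boundary (A : set X) := exists m, visits_le h hi m (boundary A).

Definition visits (A : set X) (N : nat) (x : X) : nat :=
  \sum_(i < N) `[< A (hp i x) >].

(* The points of [C] still to be placed and the places of [U] still free when
   the displacement [d] is about to be tried. *)
Fixpoint parking (C U : set X) (d : nat) : set X * set X :=
  if d is e.+1 then
    let: (C', U') := parking C U e in
    (C' `\` hp e @^-1` U', U' `\` hp (- e%:Z) @^-1` C')
  else (C, U).

Definition parked C U (d : nat) : set X :=
  (parking C U d).1 `&` hp d @^-1` (parking C U d).2.

Lemma parking1S C U d :
  (parking C U d.+1).1 = (parking C U d).1 `\` hp d @^-1` (parking C U d).2.
Proof. by rewrite /=; case: (parking C U d). Qed.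

Lemma parking2S C U d :
  (parking C U d.+1).2 = (parking C U d).2 `\` hp (- d%:Z) @^-1` (parking C U d).1.
Proof. by rewrite /=; case: (parking C U d). Qed.

Lemma parking1_sub C U d e : (d <= e)%N -> (parking C U e).1 `<=` (parking C U d).1.
Proof.
elim: e => [|e IH]; first by rewrite leqn0 => /eqP ->.
rewrite leq_eqVlt => /predU1P[->//|/IH de].
by rewrite parking1S => x [/de].
Qed.

Lemma parking2_sub C U d e : (d <= e)%N -> (parking C U e).2 `<=` (parking C U d).2.
Proof.
elim: e => [|e IH]; first by rewrite leqn0 => /eqP ->.
rewrite leq_eqVlt => /predU1P[->//|/IH de].
by rewrite parking2S => x [/de].
Qed.

Lemma parked_cover C U d x : C x -> (parking C U d).1 x \/
  exists2 e, (e < d)%N & parked C U e x.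
Proof.
move=> Cx; elim: d => [|d [IH|[e ed Pe]]]; first by left.
  have [Px|nP] := pselect ((parking C U d).2 (hp d x)).
    by right; exists d.
  by left; rewrite parking1S.
by right; exists e => //; exact: ltnW.
Qed.

Context (homh : homeomorphism h hi).
Let hK : cancel h hi. Proof. by case: homh => _ [_ []]. Qed.
Let hiK : cancel hi h. Proof. by case: homh => _ [_ []]. Qed.

Lemma parked_disjoint C U d e x y : (d < e)%N ->
  parked C U d x -> parked C U e y -> hp d x <> hp e y.
Proof.
move=> de [Cx Ux] [Cy Uy] xy.
have := parking2_sub C U _ _ de _ Uy; rewrite parking2S => -[_]; apply.
by rewrite -xy /preimage /mkset hpowK.
Qed.

Lemma parking_taken C U d y : U y -> ~ (parking C U d).2 y ->
  exists2 e, (e < d)%N & parked C U e (hp (- e%:Z) y).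
Proof.
move=> Uy; elim: d => [//|d IH].
have [U'y|/IH[e ed Pe] _] := pselect ((parking C U d).2 y); last first.
  by exists e => //; exact: ltnW.
rewrite parking2S => nU; exists d => //; split; last first.
  by rewrite /preimage /mkset hpowKN.
by apply: contrapT => nC; apply: nU; split.
Qed.

(* A point [x] never parked finds each spot it passes occupied by a point of its
   orbit strictly between [x] and the spot, and distinct spots by distinct
   points. *)
Lemma parking_exhausts C U N :
  (forall x, visits C N x < visits U N x)%N -> (parking C U N).1 = set0.
Proof.
move=> CU; rewrite -subset0 => x Cx; have := CU x; rewrite ltnNge => /negP; apply.
(* [f i] is the time at which the orbit of [x] passes the point parked at the spot [hp i x], so
   [i - f i] is the displacement of that point. Off [U] the value is a dummy. *)
have /choice[f fP] (i : 'I_N) : exists j : 'I_N, U (hp i x) ->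
    (j <= i)%N /\ parked C U (i - j) (hp j x).
  have [Ui|] := pselect (U (hp i x)); last by exists i.
  have [|e ei Pe] := parking_taken C U i _ Ui.
    have := parking1_sub C U _ _ (ltn_ord i) _ Cx.
    by rewrite parking1S => -[].
  have jN : (i - e < N)%N by exact: leq_ltn_trans (leq_subr _ _) (ltn_ord i).
  exists (Ordinal jN) => _; split; first exact: leq_subr.
  rewrite /= subKn; last exact: ltnW.
  by move: Pe; rewrite -hpowD// addrC subzn//; exact: ltnW.
have sumE A : visits A N x = #|[set i : 'I_N | `[< A (hp i x) >]]%SET|.
  rewrite /visits -sum1_card [in RHS]big_mkcond.
  by apply: eq_bigr => i _; rewrite inE; case: asboolP.
rewrite !sumE -(@card_in_imset _ _ f).
  apply/subset_leq_card/fintype.subsetP => _ /imsetP[i + ->]; rewrite !inE => /asboolP/fP.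
  by move=> [_ [+ _]] => /(parking1_sub C U _ _ (leq0n _)) ?; exact/asboolP.
move=> i k; rewrite !inE => /asboolP/fP[fi Pi] /asboolP/fP[fk Pk] fik.
apply/val_inj => /=.
suff : (i - f i = k - f k)%N by rewrite -fik in fk *; lia.
rewrite -fik in fk Pk *.
(* A point stops waiting once it is parked, so its displacement is unique; this makes [f] injective
   on the spots in [U]. *)
have aux d e y : (d < e)%N -> parked C U d y -> parked C U e y -> False.
  move=> de [_ Uy] [Cy _]; have := parking1_sub C U _ _ de _ Cy.
  by rewrite parking1S => -[].
by case: (ltngtP (i - f i) (k - f i)) => // lt;
  [case: (aux _ _ _ lt Pi Pk)|case: (aux _ _ _ lt Pk Pi)].
Qed.

Lemma small_boundaryC A : small_boundary A -> small_boundary (~` A).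
Proof. by rewrite /small_boundary boundaryC. Qed.

Lemma small_boundaryI A B : small_boundary A -> small_boundary B ->
  small_boundary (A `&` B).
Proof.
move=> [m Am] [n Bn]; exists (m + n)%N.
apply: (visits_leS h hi _ _ _ _ _ (boundaryI _ _) (leqnn _)).
exact: visits_leU.
Qed.

Lemma small_boundaryD A B : small_boundary A -> small_boundary B ->
  small_boundary (A `\` B).
Proof. by rewrite setDE => ? ?; exact/small_boundaryI/small_boundaryC. Qed.

(** By continuity the boundary of the preimage lies in the preimage of the boundary, and shifting
    time does not change the number of visits. *)
Lemma small_boundary_preimage n A : small_boundary A ->
  small_boundary (hp n @^-1` A).
Proof.
move=> [m Am]; exists m.
apply: (visits_leS h hi _ _ _ _ (visits_le_preimage h hi homh m _ n Am) _ (leqnn m)).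
move=> x [cx nx]; split.
  have : hp n @^-1` A `<=` hp n @^-1` closure A.
    by apply: preimage_subset; exact: subset_closure.
  move=> /closureS /(_ _ cx).
  by rewrite -((closure_id _).1 (hpow_closed h hi homh n _ (@closed_closure _ _))).
by move=> iA; apply: nx; exact: (hpow_continuous h hi homh n x _ iA).
Qed.

Lemma small_boundary_parking C U d : small_boundary C -> small_boundary U ->
  small_boundary (parking C U d).1 /\ small_boundary (parking C U d).2.
Proof.
move=> sC sU; elim: d => [//|d [IC IU]]; rewrite parking1S parking2S.
by split; apply: small_boundaryD => //; exact: small_boundary_preimage.
Qed.

Lemma small_boundary_parked C U d : small_boundary C -> small_boundary U ->
  small_boundary (parked C U d).
Proof.
move=> sC sU; have [? ?] := small_boundary_parking C U d sC sU.
by apply: small_boundaryI => //; exact: small_boundary_preimage.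
Qed.

Lemma visitsD A M N x :
  visits A (M + N) x = (visits A M x + visits A N (hp M x))%N.
Proof.
rewrite /visits big_split_ord/=; congr (_ + _)%N.
by apply: eq_bigr => i _; rewrite addnC iterD.
Qed.

Lemma visits_setD A B N x : (visits A N x <= visits (A `\` B) N x + visits B N x)%N.
Proof.
rewrite /visits -big_split/=; apply: leq_sum => i _.
case: asboolP => // Ai; case: (asboolP (B _)) => [_|nBi]; first by rewrite addn1.
by rewrite asboolT.
Qed.

Context (hausX : hausdorff_space X) (cptX : compact [set: X])
  (infX : ~ finite_set [set: X]) (minh : minimal_homeo h hi).

Let nX : normal_space X. Proof. exact: compact_normal. Qed.

(** Since [z] is not periodic, it can be separated from each of its next iterates, one at a time. *)
Lemma aperiodic_nbhs n z : exists W : set X, [/\ open W, W z &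
  forall k w, (0 < k < n)%N -> W w -> ~ W (hp k w)].
Proof.
elim: n => [|n [W [ oW Wz WP]]].
  by exists setT; split => //; [exact: openT|move=> k w; rewrite ltn0 andbF].
have [->|n0] := posnP n.
  by exists setT; split => //; [exact: openT|move=> [|[]]].
have zn : z != hp n z.
  by apply/eqP => /esym; exact: (minimal_aperiodic h hi homh hausX infX minh).
have := hausX; rewrite open_hausdorff => /(_ _ _ zn)[[A B] /= [zA nB] [ oA oB AB]].
exists (W `&` (A `&` hp n @^-1` B)); split.
- apply: openI => //; apply: openI => //; exact: hpow_open.
- by split => //; split; exact: set_mem.
move=> k w /andP[k0]; rewrite ltnS leq_eqVlt.
move=> /predU1P[->|kn] [Ww [Aw Bw]] [Wkw [Akw _]].
  by have : (A `&` B) (hp n w) by []; rewrite (eqP AB).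
by apply: (WP k w) => //; rewrite k0.
Qed.

Context (tsbp : top_small_boundary_property h hi).

(** The small boundary property is applied to [F] and the complement of [W]. *)
Lemma small_boundary_between (F W : set X) : closed F -> open W -> F `<=` W ->
  exists U, [/\ open U, F `<=` U, U `<=` W & small_boundary U].
Proof.
move=> cF oW FW.
have [|||U [V [[ oU oV] FU WV UV sU]]] := tsbp F (~` W).
- exact: (subclosed_compact cF cptX).
- by apply: (subclosed_compact _ cptX) => //; exact: open_closedC.
- by apply/disjoints_subset; rewrite setCK.
exists U; split => //.
  move=> x Ux; apply: contrapT => /WV Vx.
  have : (closure U `&` closure V) x by split; exact: subset_closure.
  by rewrite UV.
by have [_] := top_small_visits h hi homh _ sU.
Qed.

Lemma matching_of_visits (C U W : set X) N : small_boundary C ->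
  small_boundary U -> open W -> U `<=` W ->
  (forall x, visits C N x < visits U N x)%N ->
  exists2 A, matching h hi A W & covers A C.
Proof.
move=> sC sU oW UW CU.
have [z Uz] : U !=set0.
  apply: contrapT => /nonemptyPn U0; have := CU point.
  by rewrite {2}/visits big1 ?ltn0// U0 => i _; rewrite asboolF.
(* A reserve [V] is taken inside [Z] and [W]; the choice of [Z] allows each orbit at most one visit
   to [V] in [N + N] steps. *)
have [Z [ oZ Zz Zk]] := aperiodic_nbhs (N + N) z.
have [|||V [ oV zV VZ sV]] := small_boundary_between [set z] (Z `&` W).
- exact: closed_point.
- exact: openI.
- by move=> _ ->; split => //; exact: UW.
have V1 x : (visits V (N + N) x <= 1)%N.
  rewrite /visits; have [[i Vi]|nV] :=
    pselect (exists i : 'I_(N + N), V (hp i x)); last first.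
    by rewrite big1// => i _; rewrite asboolF// => Vi; apply: nV; exists i.
  rewrite (bigD1 i)//= big1 ?addn0 ?leq_b1// => j ji.
  rewrite asboolF// => Vj.
  have aux (k l : 'I_(N + N)) : (k < l)%N -> V (hp k x) -> V (hp l x) -> False.
    move=> kl /VZ[Zk' _] /VZ[Zl _]; apply: (Zk (l - k)%N _ _ Zk').
      by have := ltn_ord l; lia.
    by rewrite -hpowD// -PoszD subnK// ltnW.
  case: (ltngtP i j) => [ij|ij|/val_inj ij]; first exact: aux ij Vi Vj.
    exact: aux ij Vj Vi.
  by move: ji; rewrite ij eqxx.
(* Two blocks of length [N] give [U] a lead of at least two visits over [C]; removing [V] costs at
   most one, so [U'] still leads. *)
pose U' := U `\` V; pose M := (N + N)%N.
have CU' x : (visits C M x < visits U' M x)%N.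
  have := CU x; have := CU (hp N x).
  have := visitsD C N N x; have := visitsD U N N x.
  have := visits_setD U V M x; have := V1 x; rewrite -/M -/U'; lia.
pose P := parked C U'.
have sP d : small_boundary (P d).
  by apply: small_boundary_parked => //; exact: small_boundaryD.
(* The parked sets are not closed; what their closures add lies in [F], which is small and is
   matched into the reserve [V]. *)
pose F := \big[setU/set0]_(d < M) boundary (P d).
have [m Fm] : exists m, visits_le h hi m F.
  rewrite /F; elim/big_ind: _ => [|A B [m Am] [n Bn]|d _]; last exact: sP.
    by exists 0%N => x [|t s] // _ /(_ t (mem_head _ _)).
  by exists (m + n)%N; exact: visits_leU.
have cF : closed F.
  by apply: closed_bigsetU => d _; exact: closed_boundary.
have [|A2 mA2 cA2] := small_matching h hi homh nX hausX cptX infX minh _ _ V cF Fm oV.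
  by exists z; exact: zV.
have [ O [ oO AO [fO clO OV dO]]] := matching_nbhs h hi homh nX _ _ oV mA2.
(* Outside the neighbourhoods [O e] of [F], the closure of a parked set adds nothing to it: [Q d] is
   closed and still consists of parked points. *)
pose Q (d : int) : set X := if (0 <= d) && (d < M%:Z) then
  closure (P (absz d)) `\` \bigcup_e O e else set0.
have QP d x : Q d x -> [/\ 0 <= d, d < M%:Z & P (absz d) x].
  rewrite /Q; case: ifP => // /andP[d0 dM] [cPx nO]; split => //.
  apply: closure_boundary cPx _ => bP; apply: nO.
  have [|e Ae] := cA2 x; last by exists e => //; exact: AO.
  have dM' : (absz d < M)%N by lia.
  by rewrite /F -(bigcup_mkord M (fun d => boundary (P d))); exists (absz d).
have QU d x : Q d x -> U' (hp d x).
  move=> /QP[d0 dM [_ +]] => /(parking2_sub C U' _ _ (leq0n _)).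
  by rewrite /preimage /mkset gez0_abs.
have QD d e x y : Q d x -> Q e y -> hp d x = hp e y -> d = e.
  move=> /QP[d0 dM Px] /QP[e0 eM Py] xy.
  case: (ltngtP (absz d) (absz e)) => [de|de|]; last by lia.
    by have := parked_disjoint _ _ _ _ _ _ de Px Py; rewrite !gez0_abs.
  by have := parked_disjoint _ _ _ _ _ _ de Py Px; rewrite !gez0_abs// xy.
exists (fun d => Q d `|` closure (O d)); last first.
  move=> x Cx; have [[d _ Odx]|nO] := pselect ((\bigcup_d O d) x).
    by exists d; right; exact: subset_closure.
  have := parking_exhausts C U' M CU'.
  case: (parked_cover C U' M x Cx) => [+ E|[e eM Pe] _]; first by rewrite E.
  exists e; left; rewrite /Q ifT; last by apply/andP; split; lia.
  by split => //; exact: subset_closure.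
split.
- apply: (@sub_finite_set _ _ ([set d | closure (O d) !=set0] `|`
    (Posz @` `I_M))).
    move=> d [x [/QP[d0 dM _]|Ox]]; [right|left]; last by exists x.
    by exists (absz d); rewrite /=; lia.
  by rewrite finite_setU; split => //; exact/finite_image/finite_II.
- move=> d; apply: closedU; last exact: closed_closure.
  rewrite /Q; case: ifP => _; last exact: closed0.
  apply: closedI; first exact: closed_closure.
  by apply: open_closedC; exact: bigcup_open.
- by move=> d x [/QU[/UW]//|/OV/VZ[]].
- move=> d e x w [Qx|Ox] [Qw|Ow] xw.
  + exact: QD Qx Qw xw.
  + by have := OV _ _ Ow; have [_ nV] := QU _ _ Qx; rewrite -xw.
  + by have := OV _ _ Ox; have [_ nV] := QU _ _ Qw; rewrite xw.
  + exact: dO Ox Ow xw.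
Qed.

End matching_of_counts.

(** * Invariant measures from contents *)

Section content.
Context {R : realType} {X : ptopologicalType} (lambda : set X -> R)
  (lambda_ge0 : forall A, 0 <= lambda A)
  (lambdaU : forall A B, A `&` B = set0 -> lambda (A `|` B) = lambda A + lambda B)
  (lambdaT : lambda [set: X] = 1).

(** [lambda] is only finitely additive. As in the construction of a Radon measure from a content, it
    is regularized from inside by closed sets on the open sets, then from outside by open sets. *)
Definition inner_content (O : set X) : \bar R :=
  ereal_sup [set (lambda K)%:E | K in [set K | closed K /\ K `<=` O]].

Definition outer_content (E : set X) : \bar R :=
  ereal_inf [set inner_content O | O in [set O | open O /\ E `<=` O]].

Lemma content0 : lambda set0 = 0.
Proof.
have := lambdaU set0 set0 (setI0 _); rewrite setU0 => /eqP.
by rewrite -subr_eq0 opprD addNKr oppr_eq0 => /eqP.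
Qed.

Lemma content_le A B : A `<=` B -> lambda A <= lambda B.
Proof.
move=> AB; rewrite -[B](setDUK AB) lambdaU ?lerDl//.
by rewrite setDE setICA setICr setI0.
Qed.

Lemma contentU_le A B : lambda (A `|` B) <= lambda A + lambda B.
Proof.
rewrite -[A `|` B](setDUK (@subsetUl _ A B)) lambdaU.
  by rewrite lerD2l; apply: content_le => x [[]].
by rewrite setDE setICA setICr setI0.
Qed.

Lemma inner_content_ge K O : closed K -> K `<=` O ->
  ((lambda K)%:E <= inner_content O)%E.
Proof. by move=> cK KO; apply: ereal_sup_ubound; exists K. Qed.

Lemma inner_content_le O x : (forall K, closed K -> K `<=` O -> (lambda K)%:E <= x)%E ->
  (inner_content O <= x)%E.
Proof. by move=> Ox; apply: ge_ereal_sup => _ [K [cK KO] <-]; exact: Ox. Qed.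

Lemma le_inner_content O P : O `<=` P -> (inner_content O <= inner_content P)%E.
Proof.
move=> OP; apply: inner_content_le => K cK KO; apply: inner_content_ge => //.
exact: subset_trans OP.
Qed.

Lemma inner_content_ge0 O : (0 <= inner_content O)%E.
Proof.
apply: le_trans (inner_content_ge set0 O closed0 (sub0set _)).
by rewrite lee_fin.
Qed.

Lemma inner_content_le1 O : (inner_content O <= 1)%E.
Proof. by apply: inner_content_le => K _ _; rewrite lee_fin -lambdaT content_le. Qed.

Lemma outer_content_le E O : open O -> E `<=` O ->
  (outer_content E <= inner_content O)%E.
Proof. by move=> oO EO; apply: ereal_inf_lbound; exists O. Qed.

Lemma outer_content_ge E x :
  (forall O, open O -> E `<=` O -> x <= inner_content O)%E ->
  (x <= outer_content E)%E.
Proof. by move=> Ex; apply: le_ereal_inf_tmp => _ [ O [ oO EO] <-]; exact: Ex. Qed.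

Lemma outer_contentE O : open O -> outer_content O = inner_content O.
Proof.
move=> oO; apply/eqP; rewrite eq_le outer_content_le//=.
by apply: outer_content_ge => P oP; exact: le_inner_content.
Qed.

Lemma outer_content_ge0 E : (0 <= outer_content E)%E.
Proof. by apply: outer_content_ge => O _ _; exact: inner_content_ge0. Qed.

Lemma outer_content0 : outer_content set0 = 0%E.
Proof.
rewrite outer_contentE; last exact: open0.
apply/eqP; rewrite eq_le inner_content_ge0 andbT.
apply: inner_content_le => K _; rewrite subset0 => ->; by rewrite content0.
Qed.

Lemma outer_contentT : outer_content setT = 1%E.
Proof.
rewrite outer_contentE; last exact: openT.
apply/eqP; rewrite eq_le inner_content_le1/= -lambdaT.
by apply: inner_content_ge => //; exact: closedT.
Qed.

Lemma le_outer_content A B : A `<=` B -> (outer_content A <= outer_content B)%E.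
Proof.
move=> AB; apply: outer_content_ge => O oO BO; apply: outer_content_le => //.
exact: subset_trans BO.
Qed.

Lemma outer_content_fin E : outer_content E \is a fin_num.
Proof.
rewrite ge0_fin_numE ?outer_content_ge0//.
apply: le_lt_trans (le_outer_content _ _ (@subsetT _ E)) _.
by rewrite outer_contentT ltry.
Qed.

(** Normality cuts [K] into two closed pieces, one in [O] and one in [P]: [G] surrounds the part of
    [K] outside [P] and has its closure in [O]. *)
Lemma content_inner_contentU (K O P : set X) : normal_space X ->
  closed K -> open O -> open P -> K `<=` O `|` P ->
  ((lambda K)%:E <= inner_content O + inner_content P)%E.
Proof.
move=> nX cK oO oP KOP.
have [||| G [ oG KG GO]] := normal_shrink nX (K `\` P) O.
- by apply: closedI => //; exact: open_closedC.
- by [].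
- by move=> x [/KOP[]].
have cKG : closed (K `\` G) by apply: closedI => //; exact: open_closedC.
have KU : K `<=` (K `&` closure G) `|` (K `\` G).
  move=> x Kx; have [Gx|] := pselect (G x); last by right.
  by left; split => //; exact: subset_closure.
apply: (@le_trans _ _ ((lambda (K `&` closure G))%:E + (lambda (K `\` G))%:E)%E).
  by rewrite -EFinD lee_fin (le_trans (content_le _ _ KU))// contentU_le.
apply: leeD; apply: inner_content_ge => //.
- by apply: closedI => //; exact: closed_closure.
- by move=> x [_ /GO].
- by move=> x [Kx nG]; apply: contrapT => nP; apply: nG; apply: KG.
Qed.

Context (hausX : hausdorff_space X) (cptX : compact [set: X]).

Let nX : normal_space X. Proof. exact: compact_normal. Qed.

(** A closed subset of the union is compact, so finitely many of the [O n] cover it and finite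
    subadditivity is enough. *)
Lemma inner_content_subadditive (O : nat -> set X) : (forall n, open (O n)) ->
  (inner_content (\bigcup_n O n) <= \sum_(n <oo) inner_content (O n))%E.
Proof.
move=> oO; apply: inner_content_le => K cK KO.
have fin N L : closed L -> L `<=` \big[setU/set0]_(n < N) O n ->
    ((lambda L)%:E <= \sum_(n < N) inner_content (O n))%E.
  move=> cL LO; apply: (@le_trans _ _ (inner_content (\big[setU/set0]_(n < N) O n))).
    exact: inner_content_ge.
  elim: N {L cL LO} => [|N IH].
    rewrite !big_ord0; apply: inner_content_le => L _; rewrite subset0 => ->.
    by rewrite content0.
  rewrite !big_ord_recr/=; apply: inner_content_le => L cL LO.
  apply: le_trans (leeD2r _ IH); apply: content_inner_contentU => //.
  by apply: big_ind => [||n _]; [exact: open0|exact: openU|exact: oO].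
have cptK : compact K := subclosed_compact cK cptX (@subsetT _ K).
move: cptK; rewrite compact_cover => /(_ nat setT O)[|x /KO[n _ On]|D _ KD].
- by move=> n _; exact: oO.
- by exists n.
pose N := (\max_(n <- finmap.enum_fset D) n).+1.
apply: (@le_trans _ _ (\sum_(0 <= n < N) inner_content (O n))%E); last first.
  by apply: nneseries_lim_ge => n _ _; exact: inner_content_ge0.
rewrite big_mkord; apply: fin => // x /KD[n nD On].
rewrite -bigcup_mkord; exists n => //=.
by rewrite ltnS; apply: leq_bigmax_seq.
Qed.

Lemma outer_content_sigma_subadditive : sigma_subadditive outer_content.
Proof.
move=> F; apply/lee_addgt0Pr => e e0.
apply: le_trans (epsilon_trick xpredT (fun n => outer_content_ge0 (F n)) (ltW e0)).
have /choice[ O OP] n : exists O, [/\ open O, F n `<=` O &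
    (inner_content O <= outer_content (F n) + (e / (2 ^ n.+1)%:R)%:E)%E].
  have en : 0 < e / (2 ^ n.+1)%:R by rewrite divr_gt0// ltr0n expn_gt0.
  have [_ [ O [ oO FO] <-] lt] := lb_ereal_inf_adherent en (outer_content_fin (F n)).
  by exists O; split => //; exact: ltW.
have oO n : open (O n) by case: (OP n).
apply: le_trans (outer_content_le _ (\bigcup_n O n) _ _) _.
- exact: bigcup_open.
- by apply: subset_bigcup => n _; case: (OP n).
apply: le_trans (inner_content_subadditive _ oO) _.
apply: lee_nneseries => [n _ _|n _]; first exact: inner_content_ge0.
by case: (OP n).
Qed.

(** For [G] open around [E], fill [G] and [O] in common by a closed [K], then the rest of [G] by a
    closed [L]. They are disjoint, so additivity of [lambda] bounds the sum by the content of
    [G]. *)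
Lemma outer_content_open_split O E : open O ->
  (outer_content (E `&` O) + outer_content (E `&` ~` O) <= outer_content E)%E.
Proof.
move=> oO; apply: outer_content_ge => G oG EG.
apply: (@le_trans _ _ (inner_content (G `&` O) + outer_content (E `&` ~` O))%E).
  by apply: leeD2r; apply: outer_content_le; [exact: openI|exact: setSI].
rewrite -leeBrDr ?outer_content_fin//; apply: inner_content_le => K cK KGO.
rewrite leeBrDr ?outer_content_fin// addeC -leeBrDr//.
apply: (@le_trans _ _ (inner_content (G `\` K))).
  apply: outer_content_le; first by apply: openI => //; exact: closed_openC.
  by move=> x [/EG Gx nO]; split => // /KGO[].
apply: inner_content_le => L cL LGK; rewrite leeBrDr// -EFinD -lambdaU; last first.
  by rewrite -subset0 => x [/LGK[]].
apply: inner_content_ge; first exact: closedU.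
by rewrite subUset; split=> [x /LGK[]|x /KGO[]].
Qed.

(** [outer_content_open_split] makes open sets Carathéodory measurable, hence all Borel sets, and on
    these the outer measure is countably additive. *)
Lemma content_probability : exists mu : probability (borel_type X) R,
  forall E : set (borel_type X), mu E = outer_content E.
Proof.
pose om : {outer_measure set X -> \bar R} := HB.pack outer_content
  (isOuterMeasure.Build R X outer_content outer_content0 outer_content_ge0
    le_outer_content outer_content_sigma_subadditive).
have sub (A : set (borel_type X)) : measurable A -> om.-caratheodory A.
  move=> mA; apply: (smallest_sub _ _ mA) => [|O oO].
    split.
    - exact: caratheodory_measurable_set0.
    - by move=> B mB; rewrite setTD; exact: caratheodory_measurable_setC.
    - by move=> F mF; exact: caratheodory_measurable_bigcup.
  by apply: le_caratheodory_measurable => E; exact: outer_content_open_split.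
have sa : semi_sigma_additive (outer_content : set (borel_type X) -> \bar R).
  move=> F mF tF mUF.
  apply: (@caratheodory_measure_sigma_additive R X om F _ tF (sub _ mUF)) => n.
  exact: sub.
pose mu : {measure set (borel_type X) -> \bar R} := HB.pack
  (outer_content : set (borel_type X) -> \bar R)
  (isMeasure.Build _ (borel_type X) R (outer_content : set (borel_type X) -> \bar R)
    outer_content0 outer_content_ge0 sa).
pose P : probability (borel_type X) R := HB.pack
  (outer_content : set (borel_type X) -> \bar R) (Measure.class mu)
  (Measure_isProbability.Build _ (borel_type X) R mu outer_contentT).
by exists P.
Qed.

Lemma outer_content_preimage_le (f g : X -> X) (E : set X) :
  continuous f -> continuous g ->
  cancel f g -> cancel g f -> (forall A, lambda (f @^-1` A) = lambda A) ->
  (outer_content (f @^-1` E) <= outer_content E)%E.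
Proof.
move=> cf cg fK gK lf; apply: outer_content_ge => O oO EO.
apply: (@le_trans _ _ (inner_content (f @^-1` O))).
  by apply: outer_content_le; [apply: open_comp|exact: preimage_subset].
apply: inner_content_le => K cK KO.
have -> : K = f @^-1` (g @^-1` K).
  by apply/seteqP; split => x; rewrite /preimage /mkset fK.
rewrite lf; apply: inner_content_ge.
  by have /continuous_closedP := cg; exact.
by move=> x /KO; rewrite /preimage /mkset gK.
Qed.

Lemma outer_content_preimage (f g : X -> X) (E : set X) :
  continuous f -> continuous g ->
  cancel f g -> cancel g f -> (forall A, lambda (f @^-1` A) = lambda A) ->
  outer_content (f @^-1` E) = outer_content E.
Proof.
move=> cf cg fK gK lf; apply/eqP; rewrite eq_le (outer_content_preimage_le f g)//=.
have gf A : f @^-1` (g @^-1` A) = A.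
  by apply/seteqP; split => x; rewrite /preimage /mkset fK.
have fg A : g @^-1` (f @^-1` A) = A.
  by apply/seteqP; split => x; rewrite /preimage /mkset gK.
rewrite -{1}(fg E); apply: (outer_content_preimage_le g f) => // A.
by rewrite -lf gf.
Qed.

End content.

(** The image of an ultrafilter is an ultrafilter, and on a compact segment it converges. *)
Lemma ultra_cvg {R : realType} {T : Type} (G : set_system T) (f : T -> R) (a b : R) :
  UltraFilter G -> (forall t, a <= f t <= b) -> cvg (f t @[t --> G]).
Proof.
move=> UG fab; have UfG : UltraFilter (f t @[t --> G]).
  split=> [|H PH GH]; first exact: fmap_proper_filter.
  apply/seteqP; split=> // A HA; have [//|nA] := in_ultra_setVsetC (f @^-1` A) UG.
  have /GH HnA : (f t @[t --> G]) (~` A) by [].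
  have : H (A `&` ~` A) by exact: filterI.
  by rewrite setICr => /filter_ex[].
have := segment_compact (a := a) (b := b).
rewrite compact_ultra => /(_ _ UfG)[|l [_ fl]].
  have : G (f @^-1` `[a, b]) by apply: filterE => t; rewrite /= in_itv/=.
  by [].
by apply/cvg_ex; exists l.
Qed.

(** * Uniform orbit counts from invariant measures *)

Section uniform_visits.
Context {R : realType} {X : ptopologicalType} (h hi : X -> X)
  (homh : homeomorphism h hi) (hausX : hausdorff_space X)
  (cptX : compact [set: X]).
Local Notation hp := (hpow h hi).

Definition frequency (A : set X) (N : nat) (x : X) : R :=
  (visits h hi A N x)%:R / N%:R.

Lemma visits_le_time A N x : (visits h hi A N x <= N)%N.
Proof.
rewrite /visits -[leqRHS]muln1 -[in leqRHS](card_ord N) -sum_nat_const.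
by apply: leq_sum => i _; exact: leq_b1.
Qed.

Lemma visits_sub A B N x : A `<=` B -> (visits h hi A N x <= visits h hi B N x)%N.
Proof.
move=> AB; apply: leq_sum => i _.
by case: asboolP => // /AB Bi; rewrite asboolT.
Qed.

Lemma frequency_itv A N x : 0 <= frequency A N x <= 1.
Proof.
rewrite /frequency divr_ge0//=; have [->|N0] := posnP N.
  by rewrite invr0 mulr0.
by rewrite ler_pdivrMr ?ltr0n// mul1r ler_nat visits_le_time.
Qed.

Lemma frequencyU A B N x : A `&` B = set0 ->
  frequency (A `|` B) N x = frequency A N x + frequency B N x.
Proof.
move=> AB; rewrite /frequency -mulrDl -natrD /visits -big_split/=.
congr (_%:R / _); apply: eq_bigr => i _; set y := hp i x.
case: (asboolP (A y)) => Ay; case: (asboolP (B y)) => By.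
- by have : (A `&` B) y by []; rewrite AB.
- by rewrite asboolT//; left.
- by rewrite asboolT//; right.
- by rewrite asboolF// => -[].
Qed.

Lemma frequency_preimage A N x :
  `|frequency (h @^-1` A) N x - frequency A N x| <= N%:R^-1.
Proof.
rewrite /frequency -mulrBl normrM [X in _ * X]ger0_norm//.
rewrite -[leRHS]mul1r ler_wpM2r//.
(* Both sides count the visits to [A] at times from 0 to [N], so the two counts differ only by the
   end terms. *)
have : (visits h hi (h @^-1` A) N x + `[< A x >] =
        visits h hi A N x + `[< A (hp N x) >])%N.
  have -> : visits h hi (h @^-1` A) N x = visits h hi A N (hp 1%N x).
    by apply: eq_bigr => i _; rewrite /preimage /mkset /= -iterS -iterSr.
  have v1 y : visits h hi A 1 y = `[< A y >] by rewrite /visits big_ord1.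
  have := visitsD h hi A N 1 x; have := visitsD h hi A 1 N x.
  by rewrite !v1 add1n addn1; lia.
move=> /(congr1 (fun n => n%:R : R)); rewrite !natrD => E.
have -> : (visits h hi (h @^-1` A) N x)%:R - (visits h hi A N x)%:R =
  `[< A (hp N x) >]%:R - `[< A x >]%:R :> R by lra.
by case: (`[< _ >]); case: (`[< _ >]);
  rewrite ?subrr ?subr0 ?sub0r ?normrN ?normr0 ?normr1.
Qed.

(* Failure for every triple [(K, O, N)] gives orbit segments whose frequencies
   converge, along an ultrafilter on the triples, to an invariant content. *)
Lemma uniform_visits (U C : set X) : open U -> closed C ->
  (forall mu : probability (borel_type X) R, invariant_prob h mu ->
     (mu (C : set (borel_type X)) < mu (U : set (borel_type X)))%E) ->
  exists K O N, [/\ closed K /\ K `<=` U, open O /\ C `<=` O &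
    forall x, (visits h hi O N x < visits h hi K N x)%N].
Proof.
move=> oU cC muUC; apply: contrapT => nKON.
have nX : normal_space X by exact: compact_normal.
pose I : Type := (set X * set X * nat)%type.
pose D : set I := [set i | [/\ closed i.1.1, i.1.1 `<=` U, open i.1.2 & C `<=` i.1.2]].
have /choice[x xP] (i : I) : exists x, D i ->
    (visits h hi i.1.1 i.2 x <= visits h hi i.1.2 i.2 x)%N.
  have [Di|] := pselect (D i); last by exists point.
  apply: contrapT => nx; apply: nKON; exists i.1.1, i.1.2, i.2.
  case: Di => cK KU oO CO; split => // x; rewrite ltnNge; apply/negP => le.
  by apply: nx; exists x.
(* Triples are directed by enlarging [K], shrinking [O] and lengthening [N]; unions, intersections
   and maxima give common refinements. *)
pose B (i : I) : set I := [set j | [/\ D j, i.1.1 `<=` j.1.1, j.1.2 `<=` i.1.2 &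
  (i.2 <= j.2)%N]].
pose F := filter_from D B.
have PF : ProperFilter F.
  apply: filter_from_proper => [|i Di]; last by exists i; split.
  apply: filter_from_filter.
    exists ((set0, setT), 0%N); split => //=; [exact: closed0|exact: openT].
  move=> [[K O] n] [[L P] m] [/= cK KU oO CO] [/= cL LU oP CP].
  exists ((K `|` L, O `&` P), maxn n m).
    split => //=; [exact: closedU|by rewrite subUset|exact: openI|by rewrite subsetI].
  move=> [[K' O'] n'] [/= D' + + +]; rewrite subUset subsetI geq_max.
  by move=> [? ?] [? ?] /andP[? ?].
have [G [UG FG]] := ultraFilterLemma PF.
have BG i : D i -> G (B i) by move=> Di; apply: FG; exists i.
pose f A (i : I) := frequency A i.2 (x i).
have fcvg A : cvg (f A i @[i --> G]).
  by apply: (ultra_cvg _ _ 0 1) => i; exact: frequency_itv.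
pose lambda A := lim (f A i @[i --> G]).
have lambda_ge0 A : 0 <= lambda A.
  by apply: limr_ge => //; apply: nearW => i; have /andP[] := frequency_itv A i.2 (x i).
have lambdaU A A' : A `&` A' = set0 -> lambda (A `|` A') = lambda A + lambda A'.
  move=> AA'; apply: cvg_lim => //.
  have -> : f (A `|` A') = f A + f A'.
    by apply/funext => i; exact: frequencyU.
  by apply: cvgD; exact: fcvg.
(* The pair [(set0, setT)] is always admissible, so along [G] the lengths exceed every [n]. *)
have D0 n : D ((set0, setT), n) by split => //=; [exact: closed0|exact: openT].
have lambdaT : lambda setT = 1.
  apply: cvg_lim => //; apply: cvg_near_cst.
  apply: filterS (BG _ (D0 1%N)) => i [_ _ _ /= i1].
  rewrite /f /frequency /visits (eq_bigr (fun=> 1%N)) => [|j _]; last by rewrite asboolT.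
  by rewrite sum_nat_const card_ord muln1 divff// pnatr_eq0 -lt0n.
have lambdah A : lambda (h @^-1` A) = lambda A.
  apply/eqP; rewrite -subr_eq0; apply/eqP.
  suff h0 : (f (h @^-1` A) - f A) i @[i --> G] --> (0 : R).
    have lB := cvg_lim (@Rhausdorff R) (cvgB (fcvg (h @^-1` A)) (fcvg A)).
    by rewrite /lambda -lB; exact: cvg_lim h0.
  apply/cvgr0Pnorm_lt => e e0.
  have [n en] : exists n, n.+1%:R^-1 < e.
    exists (Num.truncn e^-1); rewrite invf_plt ?posrE//; exact: truncnS_gt.
  apply: filterS (BG _ (D0 n.+1)) => i [_ _ _ /= ni].
  apply: le_lt_trans (frequency_preimage A i.2 (x i)) _; apply: le_lt_trans en.
  by rewrite lef_pV2 ?posrE ?ltr0n ?ler_nat//; exact: leq_trans ni.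
(* Past the triple of [K] and [O], the bad segment chosen for a larger closed set and a smaller open
   set is also bad for [K] and [O]. *)
have lambdaKO K O : closed K -> K `<=` U -> open O -> C `<=` O -> lambda K <= lambda O.
  move=> cK KU oO CO; rewrite -subr_ge0.
  have lB := cvg_lim (@Rhausdorff R) (cvgB (fcvg O) (fcvg K)).
  rewrite /lambda -lB; apply: limr_ge; first exact: is_cvgB.
  have DKO : D ((K, O), 0%N) by [].
  apply: filterS (BG _ DKO) => i [Di /= Ki iO _].
  rewrite subr_ge0 /f /frequency ler_wpM2r// ler_nat.
  apply: leq_trans (visits_sub _ _ _ _ Ki) _.
  by apply: leq_trans (xP _ Di) _; exact: visits_sub.
have [ch [chi [hK hiK]]] := homh.
have [mu muE] := content_probability lambda lambda_ge0 lambdaU lambdaT hausX cptX.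
have mu_inv : invariant_prob h mu.
  by move=> A _; rewrite !muE; exact: (outer_content_preimage lambda h hi).
have := muUC mu mu_inv; rewrite !muE; apply/negP; rewrite -leNgt.
rewrite [leLHS]outer_contentE//; apply: inner_content_le => K cK KU.
apply: outer_content_ge => O oO CO.
(* The limit inequality bounds [lambda K] by the value at an open set, while [inner_content] sees
   closed sets; the closure of [P] passes from one to the other. *)
have [P [ oP CP PO]] := normal_shrink nX C O cC oO CO.
apply: le_trans (inner_content_ge lambda (closure P) O (@closed_closure _ _) PO).
rewrite lee_fin (le_trans (lambdaKO _ _ cK KU oP CP))//.
by apply: content_le => //; exact: subset_closure.
Qed.

End uniform_visits.

(** * From a matching to a partition of unity *)

Lemma comparison_of_matching {R : realType} {X : ptopologicalType}
    (h hi : X -> X) (A : int -> set X) (C U : set X) :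
  homeomorphism h hi -> normal_space X -> open U -> matching h hi A U ->
  covers A C ->
  exists (M : nat) (f : 'I_M.+1 -> X -> R) (d : 'I_M.+1 -> int),
    [/\ (forall j, continuous (f j)),
        (forall j x, 0 <= f j x <= 1),
        (forall x, C x -> \sum_(j < M.+1) f j x = 1),
        (forall j, supp (f j \o hpow h hi (- d j)) `<=` U) &
        (forall j k, j != k ->
           supp (f j \o hpow h hi (- d j)) `&` supp (f k \o hpow h hi (- d k))
             = set0)].
Proof.
move=> homh nX oU mA cA; have cloA d : closed (A d) by case: mA.
have [_ [_ [hK hiK]]] := homh.
have [ O [ oO AO [fO _ OU dO]]] := matching_nbhs h hi homh nX A U oU mA.
have [D ED] := (finite_seqP _).1 fO.
(* The displacement 0 is added so that the list is nonempty, as the index type ['I_M.+1] demands. *)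
pose s := undup (0 :: D); pose M := (size s).-1.
have sM : size s = M.+1.
  rewrite /M prednK// -has_predT; apply/hasP; exists 0 => //.
  by rewrite mem_undup mem_head.
have us : uniq s by exact: undup_uniq.
pose d (j : 'I_M.+1) : int := s`_j.
have d_inj j k : d j = d k -> j = k.
  by move=> /eqP; rewrite nth_uniq ?sM// => /eqP/val_inj.
pose g (e : int) : X -> R := Urysohn (~` O e) (A e).
have sep e : uniform_separator (~` O e) (A e).
  apply: (@normal_separatorP R X).1 => //; first exact: open_closedC.
  by apply/disjoints_subset; exact: subsetC.
have g01 e x : 0 <= g e x <= 1.
  have /(_ (g e x)) : range (g e) `<=` `[0, 1] by exact: Urysohn_range.
  by rewrite /= in_itv/=; apply; exists x.
have gA e x : A e x -> g e x = 1.
  by move=> Ax; apply: (Urysohn_sub1 (sep e)); exists x.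
have gO e x : g e x != 0 -> O e x.
  move=> /eqP gx; apply: contrapT => nO; apply: gx.
  by apply: (Urysohn_sub0 (sep e)); exists x.
pose S x := \sum_(j < M.+1) g (d j) x.
have cS : continuous S.
  apply: continuous_big => [|i _].
    exact: (@pseudometric_normed_Zmodule.add_continuous R R).
  exact: Urysohn_continuous.
have S_ge1 j x : A (d j) x -> 1 <= S x.
  move=> Ax; rewrite /S (bigD1 j)//= (gA _ _ Ax) lerDl sumr_ge0// => i _.
  by have /andP[] := g01 (d i) x.
(* Dividing by the maximum with 1 keeps the quotient continuous where [S] vanishes; on [C] the sum
   [S] is at least 1, so there it is the usual normalization. *)
pose f (j : 'I_M.+1) x := g (d j) x / Num.max 1 (S x).
have max0 x : 0 < Num.max 1 (S x) by rewrite lt_max ltr01.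
have supp_f j x : supp (f j \o hpow h hi (- d j)) x ->
    closure (O (d j)) (hpow h hi (- d j) x).
  have : [set x | (f j \o hpow h hi (- d j)) x != 0] `<=`
      hpow h hi (- d j) @^-1` closure (O (d j)).
    move=> y /=; rewrite /f mulf_eq0 negb_or => /andP[/gO Oy _].
    exact: subset_closure.
  move=> /closureS /[apply].
  by rewrite -((closure_id _).1 (hpow_closed h hi homh _ _ (@closed_closure _ _))).
exists M, f, d; split.
- move=> j x; apply: continuousM; first exact: Urysohn_continuous.
  apply: continuousV; first by rewrite gt_eqF.
  apply: continuous_max; first exact: cst_continuous.
  exact: cS.
- move=> j x; have /andP[g0 _] := g01 (d j) x.
  rewrite divr_ge0 ?(ltW (max0 x))//= ler_pdivrMr// mul1r le_max.
  rewrite /S (bigD1 j)//= lerDl sumr_ge0 ?orbT// => i _.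
  by have /andP[] := g01 (d i) x.
- move=> x /cA[e Ae]; have /(nthP 0)[j js je] : e \in s.
    rewrite mem_undup inE; apply/orP; right.
    have : [set` D] e by rewrite -ED; exists x; apply/subset_closure/AO.
    by [].
  rewrite sM in js; have S1 : 1 <= S x.
    by apply: (S_ge1 (Ordinal js)); rewrite /d/= je.
  by rewrite -mulr_suml -/(S x) max_r// divff// gt_eqF// (lt_le_trans ltr01).
- by move=> j x /supp_f /OU; rewrite hpowKN.
- move=> j k jk; rewrite -subset0 => x [/supp_f Oj /supp_f Ok].
  by move: jk; rewrite (d_inj j k) ?eqxx//; apply: dO Oj Ok _; rewrite !hpowKN.
Qed.

Theorem theorem5p6 (R : realType) (X : pseudoPMetricType R) (h hi : X -> X) :
  hausdorff_space X ->
  compact [set: X] ->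
  ~ finite_set [set: X] ->
  homeomorphism h hi ->
  minimal_homeo h hi ->
  top_small_boundary_property h hi ->
  dynamic_comparison_property (R := R) h hi.
Proof.
move=> hausX cptX infX homh minh tsbp U C oU cC _ _ muUC.
have nX : normal_space X by exact: compact_normal.
have [K [ O [N [[cK KU] [ oO CO] OK]]]] :=
  uniform_visits h hi homh hausX cptX U C oU cC muUC.
have between := small_boundary_between h hi homh cptX tsbp.
(* With [C'] inside [O] and [U'] containing [K], the count for [O] and [K] passes to [C'] and
   [U']. *)
have [C' [_ CC' C'O sC']] := between C O cC oO CO.
have [U' [_ KU' U'U sU']] := between K U cK oU KU.
have [x|A mA cA] := matching_of_visits h hi homh hausX cptX infX minh tsbp
  C' U' U N sC' sU' oU U'U.
  apply: leq_ltn_trans (visits_sub h hi _ _ _ _ C'O) _.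
  exact: leq_trans (OK x) (visits_sub h hi _ _ _ _ KU').
by apply: (comparison_of_matching h hi A) => // x /CC'; exact: cA.
Qed.
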